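(* Let $F$ be a number field Galois over $\mathbb Q$, $M$ an even integer divisible by the discriminant of $F$, $n\ge1$, $i\mapsto\sigma_i\in\mathrm{Gal}(F/\mathbb Q)$ ($i=1,\dots,n$, $\sigma_1=\mathrm{id}$) a vertical gauge, $p$ a prime not dividing $M$, $\mathfrak P$ a prime of $\mathcal O_F$ dividing $p$, and $q=(q_{ij})\in GL_n(\mathcal O_F[1/M])$ with $q^t=q$. Let $(\varphi_{ij})$ be the curvature of the vertical Levi-Civita connection $(\delta^1,\dots,\delta^n)$ attached to $q$ at $\mathfrak P$ and let $\Phi_{ij}=(\Phi_{ijmk})_{m,k}:=\varphi_{ij}(x)$. Let $(q^{ij})$ and $(x^{ij})$ be the inverses of the matrices $q$ and $x=(x_{ij})$, and let $$C_i=(C_{ijk})_{j,k}:=-x^{(p)t}\cdot\sigma_i^{-1}\delta^iq\cdot x^{(p)}+\frac1p\left\{(x^t\cdot\sigma_i^{-1}q\cdot x)^{(p)}-x^{(p)t}\cdot\sigma_i^{-1}q^{(p)}\cdot x^{(p)}\right\}.$$ Then for all $i,j,m,k$ the following congruences hold in $\mathcal O(\widehat{G^1})$, with the repeated indices $r,s$ summed over $1,\dots,n$: $$\Phi_{ijmk}\equiv\tfrac12(\sigma_j^{-1}q^{ms})^{p^2}(x^{rs})^{p^2}(C_{jkr}+C_{kjr}-C_{rjk})^p-\tfrac12(\sigma_i^{-1}q^{ms})^{p^2}(x^{rs})^{p^2}(C_{ikr}+C_{kir}-C_{rik})^p\quad\text{mod }p,$$ $$\Phi_{ijmk}\equiv\tfrac12(\sigma_i^{-1}q^{mr})^{p^2}(\sigma_i^{-1}\delta^iq_{kr}+\sigma_k^{-1}\delta^kq_{ir}-\sigma_r^{-1}\delta^rq_{ik})^p-\tfrac12(\sigma_j^{-1}q^{mr})^{p^2}(\sigma_j^{-1}\delta^jq_{kr}+\sigma_k^{-1}\delta^kq_{jr}-\sigma_r^{-1}\delta^rq_{jk})^p\quad\text{mod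 }(p,x-1),$$ where $(p,x-1)$ is the ideal generated by $p$, the $x_{ii}-1$, and the $x_{ij}$ for $i\ne j$.
   Context: For a matrix $a=(a_{ij})$, $a^t$ is the transpose and $a^{(p)}=(a_{ij}^p)$; set maps between rings are applied to matrices entrywise. A Frobenius lift on a ring $A$ is a ring endomorphism reducing mod $p$ to the $p$-power Frobenius of $A/pA$. On a $p$-torsion free ring a $p$-derivation $\delta$ is the same as a Frobenius lift $\phi$, via $\phi(a)=a^p+p\,\delta a$ (''attached''). $\widehat{\ }$ denotes $p$-adic completion. Set $\mathfrak P_i=\sigma_i\mathfrak P$ and let $R_i=\widehat{\mathcal O_{\mathfrak P_i}}$ be the $p$-adic completion of the localization of $\mathcal O_F$ at $\mathfrak P_i$ (a complete discrete valuation ring with maximal ideal generated by the odd prime $p$). It has a unique Frobenius lift $\phi^i$, hence a unique $p$-derivation $\delta^i$. Let $x$ be an $n\times n$ matrix of indeterminates, $G^i=\mathrm{Spec}\,R_i[x,\det(x)^{-1}]$, $\mathcal O(\widehat{G^i})=R_i[x,\det(x)^{-1}]^{\widehat{\ }}$. The automorphism $\sigma_i$ induces an isomorphism $R_1\to R_i$, extended to $\sigma_i:\mathcal O(\widehat{G^1})\to\mathcal O(\widehat{G^i})$ by $\sigma_i(x)=x$. A vertical connection at $\mathfrak P$ is an $n$-tuple $(\delta^1,\dots,\delta^n)$ where $\delta^i$ is a $p$-derivation on $\mathcal O(\widehat{G^i})$ extending that of $R_i$ (same notation), with attached Frobenius lift $\phi^i$. It is metric with respect to $q$ if for every $i$,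 $\phi^i\circ\mathcal H_q=\mathcal H_q\circ\phi^i_0$, where $\mathcal H_q$ is the (continuous) $R_i$-algebra endomorphism of $\mathcal O(\widehat{G^i})$ with $x\mapsto x^tqx$ and $\phi_0^i$ is the Frobenius lift extending that of $R_i$ with $\phi_0^i(x)=x^{(p)}$. With $\gamma_i=(\gamma_{ijk})_{j,k}:=(\delta^ix)^t\cdot\phi^i(q)\cdot x^{(p)}$, it is torsion free relative to $q$ if $\sigma_i^{-1}\gamma_{ijk}=\sigma_j^{-1}\gamma_{jik}$ for all $i,j,k$. The vertical Levi-Civita connection attached to $q$ at $\mathfrak P$ is the unique (it exists) vertical connection that is metric with respect to $q$ and torsion free relative to $q$. Its curvature is the family of additive maps $\varphi_{ij}:\mathcal O(\widehat{G^1})\to\mathcal O(\widehat{G^1})$, $i,j=1,\dots,n$, $$\varphi_{ij}=\frac1p\{\sigma_i^{-1}\phi^i\sigma_i\sigma_j^{-1}\phi^j\sigma_j-\sigma_j^{-1}\phi^j\sigma_j\sigma_i^{-1}\phi^i\sigma_i\}$$ (composition of maps, rightmost first). *)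

(* Defs.v *)
From HB Require Import structures.
From mathcomp Require Import all_boot all_order all_algebra all_fingroup all_field.
From mathcomp Require Import boolp classical_sets functions.
From mathcomp Require Import generic_quotient ring_quotient mpoly ring.

Set Implicit Arguments.
Unset Strict Implicit.
Unset Printing Implicit Defensive.

Import GRing.Theory.
Local Open Scope ring_scope.

(* The p-adic completion lim_k A / p^k A.  An element of the limit is presented
   by a coherent sequence of representatives; two coherent sequences are
   identified when their k-th terms agree modulo p^k for every k.  The proof
   argument [Ap : nonunit A p] only ensures that the completion is not the zero
   ring, as required by [comNzRingType]. *)

Section Completion.
Variables (A : comNzRingType) (p : nat).

Definition pow_dvd (k : nat) (a : A) : Prop := exists b, a = p%:R ^+ k * b.

Definition nonunit : Prop := ~ exists a : A, p%:R * a = 1.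

Definition coherent : {pred (nat -> A)} :=
  fun u => `[< forall k, pow_dvd k (u k.+1 - u k) >].

Lemma pow_dvd0 k : pow_dvd k 0.
Proof. by exists 0; rewrite mulr0. Qed.

Lemma pow_dvdD k a b : pow_dvd k a -> pow_dvd k b -> pow_dvd k (a + b).
Proof. by move=> [c ->] [d ->]; exists (c + d); rewrite mulrDr. Qed.

Lemma pow_dvdMl k a b : pow_dvd k b -> pow_dvd k (a * b).
Proof. by move=> [c ->]; exists (a * c); rewrite mulrCA. Qed.

Lemma pow_dvdB k a b : pow_dvd k a -> pow_dvd k b -> pow_dvd k (a - b).
Proof. by move=> ha hb; rewrite -mulN1r; apply/pow_dvdD/pow_dvdMl. Qed.

Lemma coherent_subring : subring_closed coherent.
Proof.
split=> [|u v /asboolP hu /asboolP hv|u v /asboolP hu /asboolP hv];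
  apply/asboolP => k.
- by rewrite subrr; apply: pow_dvd0.
- have -> : (u - v) k.+1 - (u - v) k = (u k.+1 - u k) - (v k.+1 - v k).
    by rewrite !fctE; ring.
  exact: pow_dvdB.
- have -> : (u * v) k.+1 - (u * v) k =
      u k.+1 * (v k.+1 - v k) + v k * (u k.+1 - u k).
    by rewrite !fctE; ring.
  by apply: pow_dvdD; apply: pow_dvdMl.
Qed.

HB.instance Definition _ :=
  GRing.isSubringClosed.Build (nat -> A) coherent coherent_subring.

Record coherent_seq := CoherentSeq
  { seq_of :> nat -> A; seq_ofP : seq_of \in coherent }.

HB.instance Definition _ := [isSub for seq_of].
HB.instance Definition _ := [Choice of coherent_seq by <:].
HB.instance Definition _ :=
  [SubChoice_isSubComNzRing of coherent_seq by <:].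

Definition null_seq (Ap : nonunit) : {pred coherent_seq} :=
  fun u => `[< forall k, pow_dvd k (u k) >].

Lemma null_seq_idealr (Ap : nonunit) : idealr_closed (null_seq Ap).
Proof.
split=> [||a u v /asboolP hu /asboolP hv].
- by apply/asboolP => k; apply: pow_dvd0.
- apply/negP => /asboolP /(_ 1)[b]; rewrite expr1 => hb.
  by apply: Ap; exists b; rewrite -hb.
- by apply/asboolP => k; apply/pow_dvdD/hv/pow_dvdMl/hu.
Qed.

HB.instance Definition _ (Ap : nonunit) :=
  isIdealr.Build coherent_seq (null_seq Ap) (null_seq_idealr Ap).

Definition padic (Ap : nonunit) : Type := {ideal_quot null_seq Ap}.

HB.instance Definition _ (Ap : nonunit) := GRing.ComNzRing.on (padic Ap).

Lemma cst_coherent (a : A) : (fun _ : nat => a) \in coherent.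
Proof. by apply/asboolP => k; rewrite subrr; apply: pow_dvd0. Qed.

Definition to_padic (Ap : nonunit) (a : A) : padic Ap :=
  \pi_({ideal_quot null_seq Ap})%qT (CoherentSeq (cst_coherent a)).

Lemma padic_eqP (Ap : nonunit) (u v : coherent_seq) :
  \pi_({ideal_quot null_seq Ap})%qT u = \pi_({ideal_quot null_seq Ap})%qT v <->
  forall k, pow_dvd k (u k - v k).
Proof.
split=> [/eqP|h]; last apply/eqP.
  by rewrite -Quotient.idealrBE => /asboolP.
by rewrite -Quotient.idealrBE; apply/asboolP.
Qed.

Section Units.
Variable Ap : nonunit.
Implicit Types x y : padic Ap.

Definition padic_unit : pred (padic Ap) := fun x => `[< exists y, y * x = 1 >].

Definition padic_inv x : padic Ap :=
  if pselect (exists y, y * x = 1) is left h then projT1 (cid h) else x.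

Lemma padic_mulVx : {in padic_unit, left_inverse 1 padic_inv *%R}.
Proof.
move=> x /asboolP hx; rewrite /padic_inv.
by case: pselect => // h; case: (cid h).
Qed.

Lemma padic_unitPl x y : y * x = 1 -> padic_unit x.
Proof. by move=> h; apply/asboolP; exists y. Qed.

Lemma padic_inv_out : {in [predC padic_unit], padic_inv =1 id}.
Proof. by move=> x /asboolP hx; rewrite /padic_inv; case: pselect. Qed.

HB.instance Definition _ := GRing.ComNzRing_hasMulInverse.Build (padic Ap)
  padic_mulVx padic_unitPl padic_inv_out.

End Units.

Lemma padic_nonunit (Ap : nonunit) : ~ exists u : padic Ap, p%:R * u = 1.
Proof.
move=> [u]; rewrite -[u]reprK.
have -> : p%:R = \pi_({ideal_quot null_seq Ap})%qT p%:R by rewrite rmorph_nat.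
rewrite -rmorphM -[RHS](rmorph1 (\pi_({ideal_quot null_seq Ap})%qT)).
move=> /padic_eqP /(_ 1)[b]; rewrite expr1.
rewrite [X in X - _ = _]/=.
have hp : (p%:R * repr u : coherent_seq) 1%N = p%:R * repr u 1%N.
  by rewrite [seq_of _](rmorphM \val) rmorph_nat /= mulrfctE natmulfctE.
move=> hb; have {}hb : p%:R * repr u 1%N - 1 = p%:R * b by rewrite -hp.
by case: (Ap); exists (repr u 1%N - b); rewrite mulrBr -hb subKr.
Qed.

End Completion.
Arguments nonunit : clear implicits.

(* R[x, det(x)^-1], for an m x m matrix x of indeterminates, as
   R[x][T] / (det(x) T - 1). *)

Section CoordinateRing.
Variables (R : comNzRingType) (m : nat).

Definition generic_mx : 'M[{mpoly R[m * m]}]_m :=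
  \matrix_(i, j) 'X_(mxvec_index i j).

Definition det_inv_rel : {poly {mpoly R[m * m]}} :=
  (\det generic_mx)%:P * 'X - 1.

Definition det_inv_ideal : {pred {poly {mpoly R[m * m]}}} :=
  fun f => `[< exists g, f = g * det_inv_rel >].

Definition eval1 (f : {poly {mpoly R[m * m]}}) : R :=
  (f.[1]).@[fun k => mxvec (1%:M : 'M[R]_m) 0 k].

Lemma eval1_morphism : zmod_morphism eval1 /\ monoid_morphism eval1.
Proof.
split=> [f g|]; first by rewrite /eval1 hornerD hornerN rmorphB.
by split=> [|f g]; rewrite /eval1 ?hornerM ?rmorphM // hornerC rmorph1.
Qed.

HB.instance Definition _ :=
  GRing.isZmodMorphism.Build _ _ eval1 eval1_morphism.1.
HB.instance Definition _ :=
  GRing.isMonoidMorphism.Build _ _ eval1 eval1_morphism.2.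

Lemma eval1_rel : eval1 det_inv_rel = 0.
Proof.
rewrite /eval1 /det_inv_rel !hornerE rmorphB /= rmorph1 -det_map_mx.
set v := fun k => _; have -> : map_mx (meval v) generic_mx = 1%:M.
  by apply/matrixP => i j; rewrite mxE [generic_mx _ _]mxE mevalXU /v mxvecE.
by rewrite det1 -[X in X - _](rmorph1 (meval v)) subrr.
Qed.

Lemma det_inv_idealr : idealr_closed det_inv_ideal.
Proof.
split=> [||a f g /asboolP[b ->] /asboolP[c ->]].
- by apply/asboolP; exists 0; rewrite mul0r.
- apply/negP => /asboolP[g /(congr1 eval1)].
  by rewrite rmorphM rmorph1 /= eval1_rel mulr0 => /eqP; rewrite oner_eq0.
- by apply/asboolP; exists (a * b + c); rewrite mulrDl mulrA.
Qed.

HB.instance Definition _ :=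
  isIdealr.Build {poly {mpoly R[m * m]}} det_inv_ideal det_inv_idealr.

Definition glring : Type := {ideal_quot det_inv_ideal}.

HB.instance Definition _ := GRing.ComNzRing.on glring.

Definition glring_cst (a : R) : glring :=
  \pi_({ideal_quot det_inv_ideal})%qT (a%:MP)%:P.

Definition glring_x : 'M[glring]_m :=
  \matrix_(i, j) \pi_({ideal_quot det_inv_ideal})%qT (generic_mx i j)%:P.

Lemma glring_nonunit p : nonunit R p -> nonunit glring p.
Proof.
move=> Rp [u]; rewrite -[u]reprK.
have -> : p%:R = \pi_({ideal_quot det_inv_ideal})%qT p%:R by rewrite rmorph_nat.
rewrite -rmorphM -[RHS](rmorph1 (\pi_({ideal_quot det_inv_ideal})%qT)).
move/eqP; rewrite -Quotient.idealrBE => /asboolP[g /(congr1 eval1)].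
rewrite rmorphM rmorphB rmorphM rmorph_nat rmorph1 /= eval1_rel mulr0.
by move=> /subr0_eq h; apply: Rp; exists (eval1 (repr u)).
Qed.

End CoordinateRing.
Arguments glring : clear implicits.
Arguments glring_x : clear implicits.

Definition is_int (F : fieldExtType rat) (a : F) : Prop :=
  integralOver (intr : int -> F) a.

Definition is_discriminant (F : splittingFieldType rat) (d : int) : Prop :=
  exists b : (\dim {:F}).-tuple F,
    [/\ basis_of {:F} b,
        forall i, is_int (tnth b i),
        forall a, is_int a -> exists c : 'I_(\dim {:F}) -> int,
          a = \sum_i (c i)%:~R * tnth b i
      & d%:~R = \det (\matrix_(i, j) galTrace 1 {:F} (tnth b i * tnth b j))].

(* The elements of O_F[1/M]. *)
Definition int_away (F : fieldExtType rat) (M : int) (a : F) : Prop :=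
  exists k, is_int (M%:~R ^+ k * a).

Definition in_GL_away (F : fieldExtType rat) (M : int) m (q : 'M[F]_m) : Prop :=
  [/\ q \in unitmx, forall i j, int_away M (q i j)
    & forall i j, int_away M (invmx q i j)].

(* The prime ideals of O_F dividing p. *)
Record prime_over (F : fieldExtType rat) (p : nat) := PrimeOver {
  prime_set :> F -> Prop;
  prime_int : forall a, prime_set a -> is_int a;
  prime_add : forall a b, prime_set a -> prime_set b -> prime_set (a + b);
  prime_mul : forall a b, is_int a -> prime_set b -> prime_set (a * b);
  prime_proper : ~ prime_set 1;
  prime_prime : forall a b, is_int a -> is_int b ->
    prime_set (a * b) -> prime_set a \/ prime_set b;
  prime_mem : prime_set p%:R }.

Section GaloisImage.
Variables (F : splittingFieldType rat) (p : nat).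
Variables (s : gal_of {:F}) (P : prime_over F p).

Definition gal_image (a : F) : Prop := exists2 b, P b & a = s b.

Lemma is_int_gal (t : gal_of {:F}) (a : F) : is_int a -> is_int (t a).
Proof.
move=> ha; have := integral_rmorph t ha.
by case=> f mf rf; exists f => //; move: rf; rewrite (eq_map_poly (rmorph_int t)).
Qed.

Lemma galVK (a : F) : s ((s^-1)%g a) = a.
Proof. by rewrite -galM ?memvf // mulVg gal_id. Qed.

Lemma galKV (a : F) : (s^-1)%g (s a) = a.
Proof. by rewrite -galM ?memvf // mulgV gal_id. Qed.

Lemma gal_image_int a : gal_image a -> is_int a.
Proof. by case=> b /prime_int hb ->; apply: is_int_gal. Qed.

Lemma gal_image_add a b : gal_image a -> gal_image b -> gal_image (a + b).
Proof.
move=> [c hc ->] [d hd ->]; exists (c + d); last by rewrite rmorphD.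
exact: prime_add.
Qed.

Lemma gal_image_mul a b : is_int a -> gal_image b -> gal_image (a * b).
Proof.
move=> ha [c hc ->]; exists ((s^-1)%g a * c); last by rewrite rmorphM /= galVK.
exact/prime_mul/hc/is_int_gal.
Qed.

Lemma gal_image_proper : ~ gal_image 1.
Proof.
by case=> c hc h; apply: (@prime_proper _ _ P); rewrite -(galKV 1) rmorph1 h galKV.
Qed.

Lemma gal_image_prime a b : is_int a -> is_int b ->
  gal_image (a * b) -> gal_image a \/ gal_image b.
Proof.
move=> ha hb [c hc h]; set a' := (s^-1)%g a; set b' := (s^-1)%g b.
have : P (a' * b') by rewrite /a' /b' -rmorphM h /= galKV.
case/prime_prime; [exact: is_int_gal|exact: is_int_gal|left|right].
  by exists a'; rewrite // galVK.
by exists b'; rewrite // galVK.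
Qed.

Lemma gal_image_mem : gal_image p%:R.
Proof. by exists p%:R; [exact: prime_mem|rewrite rmorph_nat]. Qed.

Definition gal_prime : prime_over F p :=
  PrimeOver gal_image_int gal_image_add gal_image_mul gal_image_proper
    gal_image_prime gal_image_mem.

End GaloisImage.

Section LocalRing.
Variables (F : fieldExtType rat) (p : nat) (P : prime_over F p).

Definition localized : {pred F} :=
  fun a => `[< exists b c, [/\ is_int b, is_int c, ~ P c & a = b / c] >].

Lemma is_intM (a b : F) : is_int a -> is_int b -> is_int (a * b).
Proof. exact: integral_mul. Qed.

Lemma notin_prime_neq0 c : ~ P c -> c != 0.
Proof.
move=> hc; apply/eqP => c0; apply: hc; rewrite c0 -(mul0r p%:R).
exact/prime_mul/prime_mem/integral0.
Qed.

Lemma notin_primeM b c :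
  is_int b -> is_int c -> ~ P b -> ~ P c -> ~ P (b * c).
Proof. by move=> hb hc nb nc /prime_prime[]. Qed.

Lemma localized_subring : subring_closed localized.
Proof.
split=> [|_ _ /asboolP[a [b [ha hb nb ->]]] /asboolP[c [d [hc hd nd ->]]]
         |_ _ /asboolP[a [b [ha hb nb ->]]] /asboolP[c [d [hc hd nd ->]]]];
  apply/asboolP.
- exists 1, 1; rewrite divr1; split=> //; [exact: integral1|exact: integral1|].
  exact: prime_proper.
- exists (a * d - c * b), (b * d); split.
  + by apply: integral_sub; apply: is_intM.
  + exact: is_intM.
  + exact: notin_primeM.
  + by rewrite -mulNr addf_div ?notin_prime_neq0 // mulNr.
- exists (a * c), (b * d); split; [exact: is_intM..| |].
  + exact: notin_primeM.
  + by rewrite mulf_div.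
Qed.

HB.instance Definition _ :=
  GRing.isSubringClosed.Build F localized localized_subring.

Record local_ring := LocalRing
  { local_val :> F; local_valP : local_val \in localized }.

HB.instance Definition _ := [isSub for local_val].
HB.instance Definition _ := [Choice of local_ring by <:].
HB.instance Definition _ := [SubChoice_isSubComNzRing of local_ring by <:].

Lemma local_nonunit : nonunit local_ring p.
Proof.
case=> -[u up] /(congr1 val); rewrite rmorphM rmorph_nat rmorph1 /= => pu.
move: up => /asboolP[b [c [hb hc nc ub]]]; apply: (nc).
have -> : c = b * p%:R.
  apply: (mulIf (invr_neq0 (notin_prime_neq0 nc))).
  by rewrite divff ?notin_prime_neq0 // mulrAC -ub mulrC.
exact/prime_mul/prime_mem.
Qed.

Definition Rhat : comUnitRingType := padic local_nonunit.

(* The embedding of the localization in its completion, as a function on F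
   (with junk value 0 on the elements of F outside the localization). *)
Definition to_Rhat (a : F) : Rhat := to_padic local_nonunit (insubd 0 a).

(* O(\hat G) = R[x, det(x)^-1]^ for R = Rhat and x an m x m matrix. *)
Definition Ghat m : comUnitRingType :=
  padic (@glring_nonunit _ m p (@padic_nonunit _ _ local_nonunit)).

Definition Rhat_Ghat m (a : Rhat) : Ghat m := to_padic _ (glring_cst m a).

Definition to_Ghat m (a : F) : Ghat m := Rhat_Ghat m (to_Rhat a).

Definition Ghat_x m : 'M[Ghat m]_m := map_mx (to_padic _) (glring_x _ m).

End LocalRing.
Arguments Rhat_Ghat {F p} P m a.
Arguments to_Ghat {F p} P m a.

Definition frob_mx (A : comNzRingType) (p : nat) m1 m2 (a : 'M[A]_(m1, m2)) :=
  map_mx (fun c => c ^+ p) a.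

Definition cong_mod (A : comNzRingType) (p : nat) (a b : A) : Prop :=
  exists c, a - b = p%:R * c.

Definition frobenius_lift (A : comNzRingType) (p : nat) (phi : A -> A) : Prop :=
  [/\ zmod_morphism phi, monoid_morphism phi
    & forall a, cong_mod p (phi a) (a ^+ p)].

Definition attached (A : comNzRingType) (p : nat) (delta : A -> A) (a : A) : A :=
  a ^+ p + p%:R * delta a.

Definition p_derivation (A : comNzRingType) (p : nat) (delta : A -> A) : Prop :=
  frobenius_lift p (attached p delta).

(* The quotient a / p, meaningful when A is p-torsion free and p divides a. *)
Definition divp (A : comNzRingType) (p : nat) (a : A) : A :=
  if pselect (exists b, p%:R * b = a) is left h then projT1 (cid h) else 0.

(* sigma : O(\hat G_P) -> O(\hat G_Q) is induced by the automorphism s of F,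
   where Q is the image of P under s.  A ring homomorphism between p-adically
   complete rings is p-adically continuous, so that the conditions below
   determine sigmaR and sigma. *)
Definition induced_by (F : splittingFieldType rat) (p m : nat)
    (P Q : prime_over F p) (s : gal_of {:F})
    (sigma : {rmorphism Ghat P m -> Ghat Q m}) : Prop :=
  exists sigmaR : {rmorphism Rhat P -> Rhat Q},
    [/\ forall a, a \in localized P -> sigmaR (to_Rhat P a) = to_Rhat Q (s a),
        bijective sigmaR,
        forall a, sigma (Rhat_Ghat P m a) = Rhat_Ghat Q m (sigmaR a)
      & map_mx sigma (Ghat_x P m) = Ghat_x Q m].

Section VerticalConnection.
Variables (F : splittingFieldType rat) (n p : nat) (P : prime_over F p).
Variable (sigma : 'I_n.+1 -> gal_of {:F}).

Definition prime_at i : prime_over F p := gal_prime (sigma i) P.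

Definition Rhat_at i : comUnitRingType := Rhat (prime_at i).

Definition Ghat_at i : comUnitRingType := Ghat (prime_at i) n.+1.

Definition cst_at i (a : Rhat_at i) : Ghat_at i :=
  Rhat_Ghat (prime_at i) n.+1 a.

Definition x_at i : 'M[Ghat_at i]_n.+1 := Ghat_x (prime_at i) n.+1.

Definition mx_at i (q : 'M[F]_n.+1) : 'M[Ghat_at i]_n.+1 :=
  map_mx (to_Ghat (prime_at i) n.+1) q.

Variable deltaR : forall i, Rhat_at i -> Rhat_at i.
Variable delta : forall i, Ghat_at i -> Ghat_at i.
Arguments deltaR : clear implicits.
Arguments delta : clear implicits.

Definition phi_at i : Ghat_at i -> Ghat_at i := attached p (delta i).

Definition vertical_connection : Prop :=
  forall i, p_derivation p (delta i) /\
    forall a, delta i (cst_at a) = cst_at (deltaR i a).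

(* H is the endomorphism x |-> x^t q x and phi0 the Frobenius lift
   x |-> x^(p).  Ring endomorphisms are p-adically continuous, so these
   conditions determine H and phi0. *)
Definition metric (q : 'M[F]_n.+1) : Prop :=
  forall i, exists (H : {rmorphism Ghat_at i -> Ghat_at i})
                   (phi0 : Ghat_at i -> Ghat_at i),
    [/\ (forall a, H (cst_at a) = cst_at a) /\
          map_mx H (x_at i) = (x_at i)^T *m mx_at i q *m x_at i,
        frobenius_lift p phi0,
        forall a, phi0 (cst_at a) = cst_at (attached p (deltaR i) a),
        map_mx phi0 (x_at i) = frob_mx p (x_at i)
      & forall a, phi_at (H a) = H (phi0 a)].

Definition gamma (q : 'M[F]_n.+1) i : 'M[Ghat_at i]_n.+1 :=
  (map_mx (delta i) (x_at i))^T *m map_mx (@phi_at i) (mx_at i q)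
  *m frob_mx p (x_at i).

(* sigmaG i is the isomorphism sigma_i : Ghat_at ord0 -> Ghat_at i, and
   sigmaV i its inverse. *)
Variable sigmaG : forall i, Ghat_at ord0 -> Ghat_at i.
Variable sigmaV : forall i, Ghat_at i -> Ghat_at ord0.
Arguments sigmaG : clear implicits.
Arguments sigmaV : clear implicits.

Definition torsion_free (q : 'M[F]_n.+1) : Prop :=
  forall i j k, sigmaV i (gamma q i j k) = sigmaV j (gamma q j i k).

Definition levi_civita (q : 'M[F]_n.+1) : Prop :=
  [/\ vertical_connection, metric q & torsion_free q].

Definition curvature i j (a : Ghat_at ord0) : Ghat_at ord0 :=
  let psi l b := sigmaV l (phi_at (sigmaG l b)) in
  divp p (psi i (psi j a) - psi j (psi i a)).

Definition Phi_mx i j : 'M[Ghat_at ord0]_n.+1 :=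
  map_mx (curvature i j) (x_at ord0).

Definition C_mx (q : 'M[F]_n.+1) i : 'M[Ghat_at ord0]_n.+1 :=
  let x := x_at ord0 in
  let xp := frob_mx p x in
  let qi := mx_at i q in
  - (xp^T *m map_mx (sigmaV i) (map_mx (delta i) qi) *m xp)
  + map_mx (divp p)
      (frob_mx p (x^T *m map_mx (sigmaV i) qi *m x)
       - xp^T *m map_mx (sigmaV i) (frob_mx p qi) *m xp).

(* Congruence modulo the ideal (p, x - 1). *)
Definition cong_mod_x1 (a b : Ghat_at ord0) : Prop :=
  exists (c : Ghat_at ord0) (e : 'M[Ghat_at ord0]_n.+1),
    a - b = p%:R * c
      + \sum_u \sum_v e u v * (x_at ord0 - 1%:M) u v.

End VerticalConnection.

(* Main.v *)
(* Conjugating by the isomorphisms sigma_i gives Frobenius lifts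
   psi_i = (a |-> a^p + p d_i a) of the p-torsion free ring A = O(\hat G^1), and
   expanding psi_i psi_j x - psi_j psi_i x modulo p^2 gives
     Phi_ij = (d_j x)^(p) - (d_i x)^(p)  mod p.
   Let Gamma_i = (d_i x)^t psi_i(q) x^(p).  Metricity says that
   Gamma_i + Gamma_i^t = C_i mod p, torsion freeness that Gamma_ijk = Gamma_jik,
   so that 2 Gamma_ijk = C_ijk + C_jik - C_kij mod p as for Christoffel symbols;
   solving for d_i x gives the first congruence.  The second one follows by
   setting x = 1: the polynomial ((sum t)^p - sum t^p) / p involves only products
   of two distinct terms, hence the fraction in C_i vanishes and C_i = - d_i q. *)

Require Import Defs.
From HB Require Import structures.
From mathcomp Require Import all_boot all_order all_algebra all_fingroup all_field.
From mathcomp Require Import boolp classical_sets functions mpoly.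
From mathcomp Require Import generic_quotient ring_quotient ring.

Set Implicit Arguments.
Unset Strict Implicit.
Unset Printing Implicit Defensive.

Import GRing.Theory.
Local Open Scope ring_scope.

Definition p_torsion_free (A : comNzRingType) (p : nat) : Prop :=
  forall a : A, p%:R * a = 0 -> a = 0.

(** * Torsion in [p]-adic completions *)

Section PadicMorphism.
Variables (A : comNzRingType) (p : nat) (Ap : nonunit A p).

Lemma to_padic_zmod : zmod_morphism (to_padic Ap).
Proof.
move=> a b; rewrite /to_padic -rmorphB; congr (\pi_(_)%qT _).
exact: val_inj.
Qed.

Lemma to_padic_monoid : monoid_morphism (to_padic Ap).
Proof.
split=> [|a b]; rewrite /to_padic.
  rewrite -[RHS](rmorph1 (\pi_({ideal_quot null_seq Ap})%qT)).
  by congr (\pi_(_)%qT _); apply: val_inj.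
by rewrite -rmorphM; congr (\pi_(_)%qT _); apply: val_inj.
Qed.

HB.instance Definition _ :=
  GRing.isZmodMorphism.Build A (padic Ap) (to_padic Ap) to_padic_zmod.
HB.instance Definition _ :=
  GRing.isMonoidMorphism.Build A (padic Ap) (to_padic Ap) to_padic_monoid.

Lemma pow_dvd_cancel k (a : A) : p_torsion_free A p ->
  pow_dvd p k.+1 (p%:R * a) -> pow_dvd p k a.
Proof.
move=> A_tf [b hb]; exists b; apply/subr0_eq/A_tf.
by rewrite mulrBr hb exprS mulrA subrr.
Qed.

(** If [p u] is null, cancelling one [p] in its term of index [k+1] leaves [u (k+1)] divisible by
    [p^k], and coherence carries this over to [u k]. *)
Lemma padic_torsion_free : p_torsion_free A p -> p_torsion_free (padic Ap) p.
Proof.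
move=> A_tf a; rewrite -[a]reprK; move: (repr a) => u.
rewrite -(rmorph_nat (\pi_({ideal_quot null_seq Ap})%qT)) -rmorphM.
rewrite -(rmorph0 (\pi_({ideal_quot null_seq Ap})%qT)).
move=> /padic_eqP pu; apply/padic_eqP => k.
have uk : pow_dvd p k (u k.+1).
  apply: pow_dvd_cancel A_tf _.
  have := pu k.+1; rewrite subr0.
  by rewrite [seq_of _](rmorphM \val) rmorph_nat /= mulrfctE natmulfctE.
rewrite subr0 -[u k](subKr (u k.+1)); apply: pow_dvdB => //.
by have /asboolP := seq_ofP u.
Qed.

End PadicMorphism.

(** * The ring [R[x, det(x)^-1]]: absence of [p]-torsion, invertibility of [x] *)

Section CoordinateRingMorphism.
Variables (R : comNzRingType) (m : nat).

Lemma glring_cst_zmod : zmod_morphism (@glring_cst R m).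
Proof.
by move=> a b; rewrite /glring_cst !rmorphB.
Qed.

Lemma glring_cst_monoid : monoid_morphism (@glring_cst R m).
Proof. by split=> [|a b]; rewrite /glring_cst ?rmorph1 ?rmorphM. Qed.

HB.instance Definition _ :=
  GRing.isZmodMorphism.Build R (glring R m) (@glring_cst R m)
    glring_cst_zmod.
HB.instance Definition _ :=
  GRing.isMonoidMorphism.Build R (glring R m) (@glring_cst R m)
    glring_cst_monoid.

Lemma mpoly_torsion_free k p :
  p_torsion_free R p -> p_torsion_free {mpoly R[k]} p.
Proof.
move=> R_tf f pf; apply/mpolyP => w; rewrite mcoeff0; apply: R_tf.
by rewrite mulr_natl -mcoeffMn -mulr_natl pf mcoeff0.
Qed.

(* [g] is determined by [p f = g (d T - 1)] through the recursion
   [g_k = g_(k-1) d - p f_k], which keeps all coefficients divisible by [p]. *)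
Lemma dvd_coef_det_inv_rel p (f g : {poly {mpoly R[m * m]}}) :
  p%:R * f = g * det_inv_rel R m -> exists h, g = p%:R * h.
Proof.
move=> pf.
have rec k : p%:R * f`_k =
    (if k is k'.+1 then g`_k' * \det (generic_mx R m) else 0) - g`_k.
  rewrite mulr_natl -coefMn -mulr_natl pf.
  rewrite /det_inv_rel mulrBr mulr1 coefB mulrA coefMX coefMC.
  by case: k.
have dvd k : exists c, g`_k = p%:R * c.
  elim: k => [|k [c hc]].
    by exists (- f`_0); rewrite mulrN rec sub0r opprK.
  exists (c * \det (generic_mx R m) - f`_k.+1).
  by rewrite mulrBr rec mulrA -hc subKr.
exists (\poly_(k < size g) projT1 (cid (dvd k))).
apply/polyP => k; rewrite mulr_natl coefMn coef_poly.
case: ltnP => hk; last by rewrite mul0rn nth_default.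
by case: (cid (dvd k)) => c /= ->; rewrite mulr_natl.
Qed.

(** If [p f] is the multiple [g (det(x) T - 1)], then [g] is itself divisible by [p]; cancelling [p]
    among polynomials puts [f] in the ideal. *)
Lemma glring_torsion_free p :
  p_torsion_free R p -> p_torsion_free (glring R m) p.
Proof.
move=> R_tf a; rewrite -[a]reprK; move: (repr a) => f.
rewrite -(rmorph_nat (\pi_({ideal_quot @det_inv_ideal R m})%qT)) -rmorphM.
rewrite -(rmorph0 (\pi_({ideal_quot @det_inv_ideal R m})%qT)).
move/eqP; rewrite -Quotient.idealrBE subr0 => /asboolP[g pf].
apply/eqP; rewrite -Quotient.idealrBE subr0; apply/asboolP.
have [h hg] := dvd_coef_det_inv_rel pf; exists h.
apply/subr0_eq/polyP => k; rewrite coef0.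
apply: (mpoly_torsion_free R_tf).
rewrite mulr_natl -coefMn -mulr_natl mulrBr pf hg.
by rewrite mulrA subrr coef0.
Qed.

(** The class of the variable [T] is the inverse, by the defining relation. *)
Lemma det_glring_x_inv : exists t, \det (glring_x R m) * t = 1.
Proof.
pose pi := \pi_({ideal_quot @det_inv_ideal R m})%qT.
exists (pi 'X).
have -> : glring_x R m = map_mx (pi \o polyC) (generic_mx R m).
  by apply/matrixP => i j; rewrite !mxE.
rewrite det_map_mx /= -rmorphM -[RHS](rmorph1 pi); apply/eqP.
rewrite -Quotient.idealrBE; apply/asboolP.
by exists 1; rewrite mul1r.
Qed.

End CoordinateRingMorphism.

(** * Congruences tested in quotient rings *)

Section IdealCongruence.
Variables (A : comNzRingType) (I : A -> Prop).
Hypotheses (I0 : I 0) (ID : forall a b, I a -> I b -> I (a + b))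
  (IM : forall a b, I b -> I (a * b)).

Definition ideal_pred (I1 : ~ I 1) : {pred A} := fun a => `[< I a >].

Lemma ideal_pred_idealr (I1 : ~ I 1) : idealr_closed (ideal_pred I1).
Proof.
split=> [||a u v /asboolP hu /asboolP hv]; first exact/asboolP.
  exact/asboolP.
by apply/asboolP/ID/hv/IM.
Qed.

HB.instance Definition _ (I1 : ~ I 1) :=
  isIdealr.Build A (ideal_pred I1) (ideal_pred_idealr I1).

(* A congruence modulo [I] can be checked in a nonzero ring killing [I]: if [I]
   is proper take [A / I], and otherwise there is nothing to prove. *)
Lemma ideal_congP (a b : A) :
  (forall (S : comNzRingType) (f : {rmorphism A -> S}),
     (forall c, I c -> f c = 0) -> f a = f b) ->
  I (a - b).
Proof.
move=> hab; have [I1|I1] := pselect (I 1).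
  by rewrite -[a - b]mulr1; apply: IM.
pose pi : {rmorphism A -> {ideal_quot ideal_pred I1}} :=
  \pi_({ideal_quot ideal_pred I1})%qT.
have /eqP : pi a = pi b.
  apply: hab => c hc; rewrite -(rmorph0 pi); apply/eqP.
  by rewrite -Quotient.idealrBE subr0; apply/asboolP.
by rewrite -Quotient.idealrBE => /asboolP.
Qed.

End IdealCongruence.

Lemma cong_mod_redP (A : comNzRingType) p (a b : A) :
  (forall (S : comNzRingType) (f : {rmorphism A -> S}),
     f p%:R = 0 -> f a = f b) ->
  cong_mod p a b.
Proof.
move=> fab; apply: (ideal_congP (I := fun c => exists d, c = p%:R * d)).
- by exists 0; rewrite mulr0.
- by move=> c d [c' ->] [d' ->]; exists (c' + d'); rewrite mulrDr.
- by move=> c d [d' ->]; exists (c * d'); rewrite mulrCA.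
by move=> S f fI; apply: fab; apply: fI; exists 1; rewrite mulr1.
Qed.

(** A morphism kills the ideal [(p, x - 1)] exactly when it kills [p] and sends [x] to the identity,
    so the second congruence can be computed at [x = 1] in characteristic [p]. *)
Lemma cong_mod_mx1_redP (A : comNzRingType) p m (x : 'M[A]_m) (a b : A) :
  (forall (S : comNzRingType) (f : {rmorphism A -> S}),
     f p%:R = 0 -> map_mx f x = 1%:M -> f a = f b) ->
  exists (c : A) (e : 'M[A]_m),
    a - b = p%:R * c + \sum_u \sum_v e u v * (x - 1%:M) u v.
Proof.
pose I (d : A) := exists (c : A) (e : 'M[A]_m),
  d = p%:R * c + \sum_u \sum_v e u v * (x - 1%:M) u v.
have sum0 : \sum_u \sum_v (0 : 'M[A]_m) u v * (x - 1%:M) u v = 0.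
  by rewrite big1 // => u _; rewrite big1 // => v _; rewrite mxE mul0r.
move=> fab; apply: (ideal_congP (I := I)).
- by exists 0, 0; rewrite sum0 mulr0 addr0.
- move=> c d [c' [e ->]] [d' [e' ->]]; exists (c' + d'), (e + e').
  rewrite mulrDr addrACA -big_split /=; congr (_ + _).
  apply: eq_bigr => u _; rewrite -big_split; apply: eq_bigr => v _ /=.
  by rewrite [(e + e') u v]mxE mulrDl.
- move=> c d [d' [e ->]]; exists (c * d'), (c *: e).
  rewrite mulrDr mulrCA mulr_sumr; congr (_ + _).
  apply: eq_bigr => u _; rewrite mulr_sumr; apply: eq_bigr => v _ /=.
  by rewrite [(c *: e) u v]mxE mulrA.
move=> S f fI; apply: fab.
  by apply: fI; exists 1, 0; rewrite sum0 mulr1 addr0.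
apply/matrixP => u v; apply/eqP; rewrite -subr_eq0; apply/eqP.
have <- : f ((x - 1%:M) u v) = map_mx f x u v - 1%:M u v.
  by rewrite !mxE rmorphB rmorph_nat.
have eE u' v' : (delta_mx u v : 'M[A]_m) u' v' = ((u' == u) && (v' == v))%:R.
  by rewrite mxE.
(* The entry [(u, v)] of [x - 1] is a generator of the ideal: its coefficient matrix is the
   elementary one. *)
apply: fI; exists 0, (delta_mx u v); rewrite mulr0 add0r; symmetry.
rewrite (bigD1 u) //= (bigD1 v) //= eE !eqxx mul1r.
rewrite big1 => [|v' /negbTE v'v]; last by rewrite eE v'v andbF mul0r.
rewrite addr0 big1 ?addr0 // => u' /negbTE u'u; rewrite big1 // => v' _.
by rewrite eE u'u mul0r.
Qed.

(** * Prime powers of sums, with control of the error term *)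

Section PrimePowers.
Variables (p : nat) (p_prime : prime p).

(** The inner binomial coefficients are divisible by [p]. The factor [a * b] is kept visible in the
    error so that a morphism killing either term kills the error divided by [p]. *)
Lemma exprD_prime (A : comNzRingType) (a b : A) :
  exists c, (a + b) ^+ p = a ^+ p + b ^+ p + p%:R * (a * b * c).
Proof.
case: p p_prime => // p' pr.
(* Index [i] stands for the binomial term [i+1], from which one factor [a] and one factor [b] have
   been taken out. *)
exists (\sum_(i < p')
  a ^+ (p' - i.+1) * b ^+ i * ('C(p'.+1, i.+1) %/ p'.+1)%:R).
rewrite exprDn big_ord_recl big_ord_recr /= /bump /= add1n subn0 subnn !expr0.
rewrite bin0 binn mulr1 mul1r !mulr1n addrCA [LHS]addrC; congr (_ + _).
rewrite !mulr_sumr; apply: eq_bigr => i _.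
have dv : (p'.+1 %| 'C(p'.+1, i.+1))%N.
  by rewrite prime_dvd_bin // !ltnS leq0n ltn_ord.
rewrite add1n subSS -{1}(divnK dv) mulrnA -[_ *+ p'.+1]mulr_natl.
rewrite -(subnSK (ltn_ord i)) !exprS -mulr_natr; ring.
Qed.

Variables (A S : comNzRingType) (f : {rmorphism A -> S}).

Lemma expr_sum_prime (J : Type) (s : seq J) (t : J -> A) :
  (forall j, f (t j) = 0) ->
  exists w, (\sum_(j <- s) t j) ^+ p = \sum_(j <- s) t j ^+ p + p%:R * w
            /\ f w = 0.
Proof.
move=> ft; elim: s => [|j s [w [hw fw]]].
  exists 0; rewrite !big_nil expr0n mulr0 addr0 rmorph0.
  by case: p p_prime.
have [c hc] := exprD_prime (t j) (\sum_(j <- s) t j).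
exists (w + t j * (\sum_(j <- s) t j) * c); rewrite !big_cons hc hw.
by rewrite mulrDr !addrA rmorphD !rmorphM ft fw !mul0r addr0.
Qed.

(* The polynomial [((sum t)^p - sum t^p) / p] is a combination of products of
   two distinct terms, so it vanishes as soon as all terms but one do. *)
Lemma expr_sum_prime_but1 (J : finType) (j0 : J) (t : J -> A) :
  (forall j, j != j0 -> f (t j) = 0) ->
  exists w, (\sum_j t j) ^+ p = \sum_j t j ^+ p + p%:R * w /\ f w = 0.
Proof.
move=> ft; pose t' j := if j == j0 then 0 else t j.
have ft' j : f (t' j) = 0.
  by rewrite /t'; case: eqVneq => [_|/ft //]; rewrite rmorph0.
have [w [hw fw]] := expr_sum_prime (index_enum J) ft'.
have t'E (h : A -> A) : h 0 = 0 -> \sum_j h (t' j) = \sum_(j | j != j0) h (t j).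
  move=> h0; rewrite (bigD1 j0) //= /t' eqxx h0 add0r.
  by apply: eq_bigr => j /negbTE ->.
rewrite (t'E id) // (t'E (fun a => a ^+ p)) in hw; last first.
  by rewrite expr0n; case: p p_prime.
have [c hc] := exprD_prime (t j0) (\sum_(j | j != j0) t j).
exists (w + t j0 * (\sum_(j | j != j0) t j) * c).
rewrite (bigD1 j0) //= hc hw [\sum_j t j ^+ p](bigD1 j0) //=.
split; first by ring.
rewrite rmorphD !rmorphM fw rmorph_sum big1 => [|j /ft //].
by rewrite mulr0 mul0r addr0.
Qed.

End PrimePowers.

Lemma divpK (A : comNzRingType) p (b : A) :
  p_torsion_free A p -> Defs.divp p (p%:R * b) = b.
Proof.
move=> A_tf; rewrite /Defs.divp; case: pselect => [h|[]]; last by exists b.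
by case: (cid h) => c /= hc; apply/subr0_eq/A_tf; rewrite mulrBr hc subrr.
Qed.

(** * Entrywise Frobenius in characteristic [p] *)

Section CharacteristicP.
Variables (S : comNzRingType) (p : nat).
Hypotheses (p_prime : prime p) (p0 : p%:R = 0 :> S).

Lemma natr0_pchar : p \in [pchar S].
Proof. by rewrite inE p_prime p0 eqxx. Qed.

Lemma frob_mxM m1 m2 m3 (a : 'M[S]_(m1, m2)) (b : 'M[S]_(m2, m3)) :
  frob_mx p (a *m b) = frob_mx p a *m frob_mx p b.
Proof. exact: (map_mxM (pFrobenius_aut natr0_pchar)). Qed.

Lemma frob_mx1 m : frob_mx p (1%:M : 'M[S]_m) = 1%:M.
Proof. exact: (map_mx1 (pFrobenius_aut natr0_pchar)). Qed.

Lemma expr_sum_pchar (J : finType) (t : J -> S) :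
  (\sum_j t j) ^+ p = \sum_j t j ^+ p.
Proof. exact: (rmorph_sum (pFrobenius_aut natr0_pchar)). Qed.

(** Frobenius fixes the image of 2, hence its inverse; this keeps the coefficient 1/2 unchanged
    under [p]-th powers. *)
Lemma exprp_inv2 (h : S) : 2%:R * h = 1 -> h ^+ p = h.
Proof.
move=> h2; have two : 2%:R ^+ p = 2%:R :> S.
  exact: (rmorph_nat (pFrobenius_aut natr0_pchar)).
have : (2%:R * h) ^+ p = 1 by rewrite h2 expr1n.
by rewrite exprMn two => e; rewrite -[RHS]mul1r -e mulrAC h2 mul1r.
Qed.

End CharacteristicP.

(** * Several Frobenius lifts on one ring: Christoffel symbols and commutators *)

Section FrobeniusLiftFamily.
Variables (p n : nat) (A : comUnitRingType).
Hypotheses (p_prime : prime p) (p_odd : odd p) (A_tf : p_torsion_free A p)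
  (unit2 : (2%:R : A) \is a GRing.unit).
Variables (psi : 'I_n.+1 -> {rmorphism A -> A}) (dl : 'I_n.+1 -> A -> A).
Hypothesis psiE : forall i a, psi i a = a ^+ p + p%:R * dl i a.
Variables (x : 'M[A]_n.+1) (Q QV : 'I_n.+1 -> 'M[A]_n.+1).
Hypotheses (x_unit : x \in unitmx) (Q_sym : forall i, (Q i)^T = Q i)
  (QVK : forall i, Q i *m QV i = 1%:M).

Let xp := frob_mx p x.
Let Gam i : 'M[A]_n.+1 := (map_mx (dl i) x)^T *m map_mx (psi i) (Q i) *m xp.

Hypothesis psi_metric : forall i,
  map_mx (psi i) (x^T *m Q i *m x) = frob_mx p (x^T *m Q i *m x).
Hypothesis psi_torsion_free : forall i j k, Gam i j k = Gam j i k.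

Let C i : 'M[A]_n.+1 := - (xp^T *m map_mx (dl i) (Q i) *m xp)
  + map_mx (Defs.divp p)
      (frob_mx p (x^T *m Q i *m x) - xp^T *m frob_mx p (Q i) *m xp).

Lemma map_liftE m1 m2 i (a : 'M[A]_(m1, m2)) :
  map_mx (psi i) a = frob_mx p a + p%:R *: map_mx (dl i) a.
Proof. by apply/matrixP => u v; rewrite !mxE psiE. Qed.

Lemma inv_form_sym i : (QV i)^T = QV i.
Proof.
rewrite -[LHS]mulmx1 -(QVK i) mulmxA -{1}(Q_sym i) -trmx_mul QVK.
by rewrite trmx1 mul1mx.
Qed.

Lemma map_divpK (b : 'M[A]_n.+1) : map_mx (Defs.divp p) (p%:R *: b) = b.
Proof. by apply/matrixP => u v; rewrite !mxE divpK. Qed.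

(** By metricity the first term of the fraction is [psi i] of [x^t Q x], a product in which
    [psi i x] is [x^(p) + p d]. The terms linear in [d] give [Gam i] and its transpose, the
    quadratic one gives [e], and the part of [psi i (Q i)] carrying [p] cancels the first summand of
    [C i]. *)
Lemma metric_symmetrization i : exists e, C i = Gam i + (Gam i)^T + p%:R *: e.
Proof.
set d := map_mx (dl i) x; set Qp := map_mx (psi i) (Q i).
have Qp_sym : Qp^T = Qp by rewrite /Qp map_trmx Q_sym.
have GamT : (Gam i)^T = xp^T *m Qp *m d.
  by rewrite /Gam !trmx_mul trmxK -/Qp Qp_sym mulmxA.
exists (d^T *m Qp *m d); rewrite /C -psi_metric !map_mxM -/Qp.
rewrite -map_trmx map_liftE -/xp -/d.
have -> : (xp + p%:R *: d)^T = xp^T + p%:R *: d^T.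
  by apply/matrixP => u v; rewrite !mxE.
have QpE : xp^T *m Qp *m xp = xp^T *m frob_mx p (Q i) *m xp
    + p%:R *: (xp^T *m map_mx (dl i) (Q i) *m xp).
  by rewrite /Qp map_liftE mulmxDr mulmxDl -scalemxAr -scalemxAl.
rewrite !mulmxDl !mulmxDr -!(scalemxAl, scalemxAr) QpE GamT /Gam -/d -/Qp.
move: (d^T *m Qp *m d) (xp^T *m Qp *m d) (d^T *m Qp *m xp) => e1 e2 e3.
move: (xp^T *m frob_mx p (Q i) *m xp) (xp^T *m _ *m xp) => e4 e5.
have -> : e4 + p%:R *: e5 + p%:R *: e2
      + (p%:R *: e3 + p%:R *: (p%:R *: e1)) - e4
    = p%:R *: (e5 + (e3 + e2 + p%:R *: e1)).
  by apply/matrixP => u v; rewrite !mxE; ring.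
by rewrite map_divpK addKr.
Qed.

(** Modulo [p^2], [psi i (psi j a)] is [a^(p^2) + p (dl j a)^p]: the correction [p dl i a] inside a
    [p]-th power contributes only multiples of [p^2]. The first terms cancel in the commutator. *)
Lemma commutator_cong i j a : exists c,
  Defs.divp p (psi i (psi j a) - psi j (psi i a))
    = dl j a ^+ p - dl i a ^+ p + p%:R * c.
Proof.
have lift (u b : A) :
    exists e, (u + p%:R * b) ^+ p = u ^+ p + p%:R * (p%:R * e).
  have [c ->] := exprD_prime p_prime u (p%:R * b).
  exists (p%:R ^+ (p - 2) * b ^+ p + u * b * c).
  (* Since [p >= 2], the power [(p b)^p] already contains [p^2]. *)
  have pE : p%:R ^+ p = p%:R * (p%:R * p%:R ^+ (p - 2)) :> A.
    by rewrite -!exprS -[(p - 2).+2]addn2 subnK ?prime_gt1.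
  by rewrite exprMn pE; ring.
have [e he] := lift (a ^+ p) (dl i a).
have [e' he'] := lift (a ^+ p) (dl j a).
exists (e - e' + dl i (dl j a) - dl j (dl i a)); rewrite -[RHS](divpK _ A_tf).
congr (Defs.divp p _); rewrite (psiE j a) (psiE i a).
rewrite !rmorphD !rmorphM !rmorph_nat.
rewrite !rmorphXn /= (psiE i a) (psiE j a) he he' !psiE; ring.
Qed.

Section Reduction.
Variables (S : comNzRingType) (f : {rmorphism A -> S}).
Hypothesis fp : f p%:R = 0.

Let h := f 2%:R^-1.

Lemma red_natr0 : p%:R = 0 :> S.
Proof. by rewrite -(rmorph_nat f). Qed.

Lemma inv2_red : 2%:R * h = 1.
Proof. by rewrite -(rmorph_nat f) -rmorphM divrr // rmorph1. Qed.

Lemma metric_defect_red i u v : f (C i u v) = f (Gam i u v) + f (Gam i v u).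
Proof.
have [e ->] := metric_symmetrization i; rewrite !mxE !rmorphD.
by rewrite rmorphM fp mul0r addr0.
Qed.

(* The Christoffel trick: [Gam] is symmetric in its first two indices. *)
Lemma christoffel_red i u v :
  f (Gam i u v) = h * f (C i u v + C u i v - C v i u).
Proof.
rewrite rmorphB rmorphD !metric_defect_red.
rewrite (psi_torsion_free u i) (psi_torsion_free v i).
rewrite (psi_torsion_free v u) -[LHS]mul1r -inv2_red; ring.
Qed.

(** After reduction [psi j (Q j)] becomes the Frobenius twist of [Q j]. Twisting entries is
    multiplicative there, so the twists of the inverses of [x] and [Q j] undo the two right factors
    of [Gam j]. *)
Lemma deriv_coords_red j m k : f (dl j (x m k)) =
  \sum_r \sum_s f (Gam j k r) * f (invmx x r s) ^+ p * f (QV j m s) ^+ p.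
Proof.
have GamS : map_mx f (Gam j) = (map_mx f (map_mx (dl j) x))^T
    *m frob_mx p (map_mx f (Q j)) *m frob_mx p (map_mx f x).
  rewrite /Gam !map_mxM map_trmx; congr (_ *m _ *m _);
    apply/matrixP => u v; rewrite !mxE ?rmorphXn //.
  by rewrite psiE rmorphD rmorphM fp mul0r addr0 rmorphXn.
have : (map_mx f (map_mx (dl j) x))^T = map_mx f (Gam j)
    *m frob_mx p (map_mx f (invmx x)) *m frob_mx p (map_mx f (QV j)).
  rewrite GamS -[_ *m frob_mx p (map_mx f x) *m _]mulmxA.
  rewrite -(frob_mxM p_prime red_natr0).
  rewrite -map_mxM mulmxV // map_mx1 (frob_mx1 p_prime red_natr0) mulmx1.
  rewrite -mulmxA -(frob_mxM p_prime red_natr0) -map_mxM QVK map_mx1.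
  by rewrite (frob_mx1 p_prime red_natr0) mulmx1.
(* The indices are swapped because the matrix of derivatives is transposed; symmetry of [QV j]
   restores the order [m s]. *)
move/matrixP => /(_ k m); rewrite !mxE => ->; rewrite exchange_big /=.
apply: eq_bigr => s _; rewrite !mxE mulr_suml; apply: eq_bigr => r _.
by rewrite !mxE -[in QV j s m](inv_form_sym j) mxE.
Qed.

(** One more Frobenius passes through the sums, turns the exponents [p] into [p^2], and raises the
    Christoffel combination to the power [p]. *)
Lemma deriv_coords_expr_red j m k : f (dl j (x m k)) ^+ p =
  f (\sum_r \sum_s 2%:R^-1 * QV j m s ^+ (p ^ 2) * invmx x r s ^+ (p ^ 2)
       * (C j k r + C k j r - C r j k) ^+ p).
Proof.
rewrite deriv_coords_red rmorph_sum (expr_sum_pchar p_prime red_natr0).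
apply: eq_bigr => r _.
rewrite rmorph_sum (expr_sum_pchar p_prime red_natr0); apply: eq_bigr => s _.
rewrite christoffel_red !exprMn (exprp_inv2 p_prime red_natr0 inv2_red).
rewrite -!exprM mulnn.
rewrite !rmorphM !rmorphXn -/h; ring.
Qed.

Lemma commutator_red i j m k :
  f (Defs.divp p (psi i (psi j (x m k)) - psi j (psi i (x m k)))) =
  f (\sum_r \sum_s 2%:R^-1 * QV j m s ^+ (p ^ 2) * invmx x r s ^+ (p ^ 2)
          * (C j k r + C k j r - C r j k) ^+ p
     - \sum_r \sum_s 2%:R^-1 * QV i m s ^+ (p ^ 2) * invmx x r s ^+ (p ^ 2)
          * (C i k r + C k i r - C r i k) ^+ p).
Proof.
have [c ->] := commutator_cong i j (x m k).
rewrite [RHS]rmorphB /= -!deriv_coords_expr_red rmorphD rmorphM.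
by rewrite fp mul0r addr0 rmorphB !rmorphXn.
Qed.

Hypothesis fx : map_mx f x = 1%:M.

Lemma metric_defect_red1 i : map_mx f (C i) = - map_mx f (map_mx (dl i) (Q i)).
Proof.
have fxp : map_mx f xp = 1%:M.
  rewrite -(frob_mx1 p_prime red_natr0) -fx.
  by apply/matrixP => u v; rewrite !mxE rmorphXn.
rewrite /C map_mxD map_mxN !map_mxM -map_trmx fxp trmx1 mul1mx mulmx1.
rewrite -[RHS]addr0; congr (_ + _).
apply/matrixP => u v.
(* The entry [(u, v)] of [x^t Q x] is the sum of [t] over all pairs; at [x = 1] only the term of the
   pair [(u, v)] can survive. *)
pose t (c : 'I_n.+1 * 'I_n.+1) := x c.1 u * Q i c.1 c.2 * x c.2 v.
have fxE a b : f (x a b) = (a == b)%:R.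
  by move/matrixP: fx => /(_ a b); rewrite !mxE.
have ft c : c != (u, v) -> f (t c) = 0.
  rewrite /t -pair_eqE negb_and !rmorphM !fxE /= => /orP[]/negbTE->.
    by rewrite !mul0r.
  by rewrite mulr0.
have [w [hw fw]] := expr_sum_prime_but1 p_prime ft.
have tE (a y : 'M[A]_n.+1) :
    (y^T *m a *m y) u v = \sum_c y c.1 u * a c.1 c.2 * y c.2 v.
  rewrite mxE -(pair_big predT predT (fun b c => y b u * a b c * y c v)) /=.
  rewrite exchange_big /=; apply: eq_bigr => c _.
  by rewrite mxE mulr_suml; apply: eq_bigr => b _; rewrite mxE.
have NE : (frob_mx p (x^T *m Q i *m x) - xp^T *m frob_mx p (Q i) *m xp) u v
    = p%:R * w.
  transitivity ((x^T *m Q i *m x) u v ^+ p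
    - (xp^T *m frob_mx p (Q i) *m xp) u v).
    by rewrite mxE [X in X + _]mxE [X in _ + X]mxE.
  rewrite !tE hw addrAC -[RHS]add0r; congr (_ + _).
  apply/eqP; rewrite subr_eq0; apply/eqP/eq_bigr => c _.
  by rewrite /xp !mxE -!exprMn.
rewrite [LHS]mxE [in LHS]mxE NE divpK // [RHS]mxE; exact: fw.
Qed.

Lemma commutator_red1 i j m k :
  f (Defs.divp p (psi i (psi j (x m k)) - psi j (psi i (x m k)))) =
  f (\sum_r 2%:R^-1 * QV i m r ^+ (p ^ 2)
          * (dl i (Q i k r) + dl k (Q k i r) - dl r (Q r i k)) ^+ p
     - \sum_r 2%:R^-1 * QV j m r ^+ (p ^ 2)
          * (dl j (Q j k r) + dl k (Q k j r) - dl r (Q r j k)) ^+ p).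
Proof.
have term l : f (dl l (x m k)) ^+ p =
    - f (\sum_r 2%:R^-1 * QV l m r ^+ (p ^ 2)
          * (dl l (Q l k r) + dl k (Q k l r) - dl r (Q r l k)) ^+ p).
  have fV : map_mx f (invmx x) = 1%:M.
    by rewrite -[LHS]mul1mx -fx -map_mxM mulmxV // map_mx1.
  have fVE r s : f (invmx x r s) = (r == s)%:R.
    by move/matrixP: fV => /(_ r s); rewrite !mxE.
  have CE c a b : f (C c a b) = - f (dl c (Q c a b)).
    by move/matrixP: (metric_defect_red1 c) => /(_ a b); rewrite !mxE.
  rewrite deriv_coords_expr_red !rmorph_sum -sumrN; apply: eq_bigr => r _.
  (* The inverse of [x] also reduces to the identity, which leaves only [s = r]. *)
  rewrite rmorph_sum (bigD1 r) //= big1 => [|s /negbTE sr]; last first.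
    rewrite !rmorphM !rmorphXn /= fVE eq_sym sr expr0n.
    by rewrite -(prednK (prime_gt0 p_prime)) expnS muln_eq0 /= mulr0 mul0r.
  rewrite addr0 !rmorphM !rmorphXn /= fVE eqxx expr1n mulr1 -mulrN.
  congr (_ * _); rewrite !rmorphB !rmorphD /= !CE.
  (* As [p] is odd, the sign in [C = - dl Q] comes out of the [p]-th power; this is why [i] and [j]
     trade places compared with the first congruence. *)
  by rewrite -!opprD exprNn -signr_odd p_odd expr1 mulN1r.
have [c ->] := commutator_cong i j (x m k).
rewrite rmorphD rmorphM fp mul0r addr0 rmorphB !rmorphXn /= !term.
by rewrite [RHS]rmorphB opprK addrC.
Qed.

End Reduction.

End FrobeniusLiftFamily.

(** * The localization at a prime and its image in the completed coordinate ring *)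

Section LocalRingFacts.
Variables (F : fieldExtType rat) (p : nat) (P : prime_over F p).

Lemma natr_ext_eq0 k : (k%:R == 0 :> F) = (k == 0)%N.
Proof. by rewrite -(rmorph_nat (in_alg F)) fmorph_eq0 Num.Theory.pnatr_eq0. Qed.

Lemma is_int_intr (z : int) : is_int (z%:~R : F).
Proof. exact: integral_id. Qed.

Lemma local_ring_torsion_free : (0 < p)%N -> p_torsion_free (local_ring P) p.
Proof.
move=> p_gt0 a /(congr1 val); rewrite rmorphM rmorph_nat rmorph0 => /eqP.
rewrite mulf_eq0 natr_ext_eq0 -[p == 0]leqn0 leqNgt p_gt0 => /eqP a0.
by apply: val_inj; rewrite [RHS](rmorph0 \val).
Qed.

(** Otherwise a Bezout relation between [p] and [z] would put 1 in [P]. *)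
Lemma coprime_notin_prime (z : int) : coprimez p z -> ~ P z%:~R.
Proof.
case/coprimezP=> [[u v]] /= uv Pz; apply: (@prime_proper _ _ P).
rewrite -[1]/(1%:~R) -uv rmorphD !rmorphM /=.
apply: prime_add; apply: prime_mul => //; try exact: is_int_intr.
exact: prime_mem.
Qed.

Lemma notin_prime_exp (c : F) k : is_int c -> ~ P c ->
  is_int (c ^+ k) /\ ~ P (c ^+ k).
Proof.
move=> c_int Pc; elim: k => [|k [IHi IHP]].
  by split; [exact: integral1|exact: prime_proper].
by rewrite exprS; split; [exact: is_intM|exact: notin_primeM].
Qed.

Lemma int_away_localized (M : int) (a : F) :
  coprimez p M -> int_away M a -> a \in localized P.
Proof.
move=> cM [k hk]; apply/asboolP.
have [Mk_int Mk_P] := notin_prime_exp k (is_int_intr M)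
  (coprime_notin_prime cM).
exists (M%:~R ^+ k * a), (M%:~R ^+ k); split=> //.
by rewrite mulrAC divff ?mul1r // (notin_prime_neq0 Mk_P).
Qed.

Lemma local_ring_unit2 : coprimez p 2 -> exists h : local_ring P, 2%:R * h = 1.
Proof.
move=> c2; have P2 := coprime_notin_prime c2.
have h_local : (2%:R^-1 : F) \in localized P.
  apply/asboolP; exists 1, 2%:~R; split=> //; first exact: integral1.
    exact: is_int_intr.
  by rewrite div1r.
exists (LocalRing h_local); apply: val_inj.
by rewrite rmorphM rmorph_nat rmorph1 /= divff // natr_ext_eq0.
Qed.

Variable m : nat.

(** Because of its junk values [to_Ghat] need not be a morphism on [F]; its restriction to the
    localization is one. *)
Definition local_Ghat (a : local_ring P) : Ghat P m :=
  Rhat_Ghat P m (to_padic _ a).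

Lemma local_Ghat_zmod : zmod_morphism local_Ghat.
Proof. by move=> a b; rewrite /local_Ghat /Rhat_Ghat !rmorphB. Qed.

Lemma local_Ghat_monoid : monoid_morphism local_Ghat.
Proof. by split=> [|a b]; rewrite /local_Ghat /Rhat_Ghat ?rmorph1 ?rmorphM. Qed.

HB.instance Definition _ :=
  GRing.isZmodMorphism.Build (local_ring P) (Ghat P m) local_Ghat
    local_Ghat_zmod.
HB.instance Definition _ :=
  GRing.isMonoidMorphism.Build (local_ring P) (Ghat P m) local_Ghat
    local_Ghat_monoid.

(** The matrices are lifted to the localization, where the product identity holds because the
    inclusion in [F] is injective, and then mapped by the morphism [local_Ghat]. *)
Lemma to_Ghat_mulmx1 k (a b : 'M[F]_k) :
  (forall i j, a i j \in localized P) -> (forall i j, b i j \in localized P) ->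
  a *m b = 1%:M ->
  map_mx (to_Ghat P m) a *m map_mx (to_Ghat P m) b = 1%:M.
Proof.
move=> ha hb ab.
pose loc (c : 'M[F]_k) : 'M[local_ring P]_k := map_mx (insubd 0) c.
have locK (c : 'M[F]_k) : (forall i j, c i j \in localized P) ->
    map_mx val (loc c) = c.
  by move=> hc; apply/matrixP => i j; rewrite !mxE insubdK.
have locE (c : 'M[F]_k) : map_mx (to_Ghat P m) c = map_mx local_Ghat (loc c).
  by apply/matrixP => i j; rewrite !mxE.
rewrite !locE -map_mxM (_ : loc a *m loc b = 1%:M) ?map_mx1 //.
have : map_mx val (loc a *m loc b) = map_mx val (1%:M : 'M[local_ring P]_k).
  by rewrite map_mxM !locK // ab map_mx1.
move/matrixP => h; apply/matrixP => i j; apply: val_inj.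
by have := h i j; rewrite !mxE.
Qed.

Lemma Ghat_torsion_free : (0 < p)%N -> p_torsion_free (Ghat P m) p.
Proof.
move=> p_gt0; apply/padic_torsion_free/glring_torsion_free/padic_torsion_free.
exact: local_ring_torsion_free.
Qed.

Lemma Ghat_unit2 : coprimez p 2 -> (2%:R : Ghat P m) \is a GRing.unit.
Proof.
case/local_ring_unit2 => h h2; apply/unitrPr; exists (local_Ghat h).
by rewrite -(rmorph_nat local_Ghat) -rmorphM h2 rmorph1.
Qed.

Lemma Ghat_x_unit : Ghat_x P m \in unitmx.
Proof.
rewrite unitmxE; apply/unitrPr.
have [t ht] := det_glring_x_inv (padic (@local_nonunit F p P)) m.
exists (to_padic _ t).
by rewrite /Ghat_x det_map_mx -rmorphM ht rmorph1.
Qed.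

End LocalRingFacts.

(** The inverses of the [sigma_i] and the Frobenius lifts are given as bare functions; bundling them
    makes the morphism lemmas apply. *)
Definition rmorphism_of (A B : comNzRingType) (f : A -> B)
    (fz : zmod_morphism f) (fm : monoid_morphism f) : {rmorphism A -> B} :=
  HB.pack f (GRing.isZmodMorphism.Build A B f fz)
    (GRing.isMonoidMorphism.Build A B f fm).

(** * Transport of the connection from the rings [B i] to the single ring [A] *)

Section TransportedConnection.
Variables (p n : nat) (A : comUnitRingType) (B : 'I_n.+1 -> comUnitRingType).
Variables (G : forall i, {rmorphism A -> B i}) (V : forall i, B i -> A)
  (delta : forall i, B i -> B i).
Arguments V : clear implicits.
Arguments delta : clear implicits.
Variables (x : 'M[A]_n.+1) (y q qV : forall i, 'M[B i]_n.+1).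

Let phi i := attached p (delta i).
Arguments phi : clear implicits.
Let gam i := (map_mx (delta i) (y i))^T *m map_mx (phi i) (q i)
  *m frob_mx p (y i).

Hypotheses (p_prime : prime p) (p_odd : odd p) (A_tf : p_torsion_free A p)
  (unit2 : (2%:R : A) \is a GRing.unit) (x_unit : x \in unitmx).
Hypotheses (GK : forall i, cancel (G i) (V i))
  (VK : forall i, cancel (V i) (G i)).
Hypotheses (Gx : forall i, map_mx (G i) x = y i)
  (q_sym : forall i, (q i)^T = q i) (qVK : forall i, q i *m qV i = 1%:M).
Hypotheses (phi_lift : forall i, frobenius_lift p (phi i))
  (phi_metric : forall i, map_mx (phi i) ((y i)^T *m q i *m y i)
     = frob_mx p ((y i)^T *m q i *m y i))
  (gam_torsion_free : forall i j k, V i (gam i j k) = V j (gam j i k)).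

Let sV i : {rmorphism B i -> A} :=
  rmorphism_of (can2_zmod_morphism (@GK i) (@VK i))
    (can2_monoid_morphism (@GK i) (@VK i)).

Let phiR i : {rmorphism B i -> B i} :=
  rmorphism_of (let: And3 fz _ _ := phi_lift i in fz)
    (let: And3 _ fm _ := phi_lift i in fm).

Let psi i : {rmorphism A -> A} := sV i \o phiR i \o G i.
Let dl i (a : A) : A := V i (delta i (G i a)).
Let Q i : 'M[A]_n.+1 := map_mx (sV i) (q i).
Let QV i : 'M[A]_n.+1 := map_mx (sV i) (qV i).
Let xp := frob_mx p x.

Lemma transported_liftE i a : psi i a = a ^+ p + p%:R * dl i a.
Proof.
rewrite -[LHS]/(sV i (G i a ^+ p + p%:R * delta i (G i a))).
rewrite rmorphD rmorphM rmorph_nat rmorphXn.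
by rewrite -[sV i (G i a)]/(V i _) GK.
Qed.

Lemma transported_form_sym i : (Q i)^T = Q i.
Proof. by rewrite /Q map_trmx q_sym. Qed.

Lemma transported_form_inv i : Q i *m QV i = 1%:M.
Proof. by rewrite /Q /QV -map_mxM qVK map_mx1. Qed.

Lemma frob_map_rmorphism (R D : comNzRingType) (g : {rmorphism R -> D}) m1 m2
    (a : 'M[R]_(m1, m2)) : frob_mx p (map_mx g a) = map_mx g (frob_mx p a).
Proof. by apply/matrixP => u v; rewrite !mxE rmorphXn. Qed.

Lemma map_inv_coords i : map_mx (sV i) (y i) = x.
Proof. by rewrite -Gx; apply/matrixP => u v; rewrite !mxE /= GK. Qed.

Lemma map_lift_transport i m1 m2 (a : 'M[B i]_(m1, m2)) :
  map_mx (psi i) (map_mx (sV i) a) = map_mx (sV i) (map_mx (phi i) a).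
Proof. by apply/matrixP => u v; rewrite !mxE /= VK. Qed.

Lemma transported_metric i :
  map_mx (psi i) (x^T *m Q i *m x) = frob_mx p (x^T *m Q i *m x).
Proof.
have -> : x^T *m Q i *m x = map_mx (sV i) ((y i)^T *m q i *m y i).
  by rewrite !map_mxM -map_trmx map_inv_coords.
by rewrite map_lift_transport phi_metric frob_map_rmorphism.
Qed.

Lemma transported_torsion_free i j k :
  ((map_mx (dl i) x)^T *m map_mx (psi i) (Q i) *m xp) j k =
  ((map_mx (dl j) x)^T *m map_mx (psi j) (Q j) *m xp) i k.
Proof.
(* The inverse isomorphism carries [gam l] to the matrix built from the transported lift. *)
have GamE l : (map_mx (dl l) x)^T *m map_mx (psi l) (Q l) *m xp
    = map_mx (sV l) (gam l).
  rewrite /gam !map_mxM -map_trmx -frob_map_rmorphism map_inv_coords.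
  rewrite -map_lift_transport.
  congr ((_)^T *m _ *m _).
  by rewrite -Gx; apply/matrixP => u v; rewrite !mxE.
by rewrite !GamE mxE [RHS]mxE; apply: gam_torsion_free.
Qed.

(** Stated with the bare maps [V] and [delta] so that it is convertible with [C_mx]; the next lemma
    restates it through [dl] and [Q]. *)
Definition transported_C i : 'M[A]_n.+1 :=
  - (xp^T *m map_mx (V i) (map_mx (delta i) (q i)) *m xp)
  + map_mx (@Defs.divp _ p) (frob_mx p (x^T *m map_mx (V i) (q i) *m x)
      - xp^T *m map_mx (V i) (frob_mx p (q i)) *m xp).
Let C := transported_C.

Lemma transported_C_liftE i : C i = - (xp^T *m map_mx (dl i) (Q i) *m xp)
  + map_mx (@Defs.divp _ p) (frob_mx p (x^T *m Q i *m x)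
      - xp^T *m frob_mx p (Q i) *m xp).
Proof.
rewrite /C /transported_C frob_map_rmorphism; congr (- (_ *m _ *m _) + _).
by apply/matrixP => u v; rewrite !mxE /dl /= VK.
Qed.

Lemma transported_derivE i u v : V i (delta i (q i u v)) = dl i (Q i u v).
Proof. by rewrite /dl mxE /= VK. Qed.

Definition transported_curvature i j (a : A) : A :=
  let psi' l b := V l (phi l (G l b)) in
  Defs.divp p (psi' i (psi' j a) - psi' j (psi' i a)).

Section Reduction.
Variables (S : comNzRingType) (f : {rmorphism A -> S}).
Hypothesis fp : f p%:R = 0.

Lemma curvature_red i j m k :
  f (transported_curvature i j (x m k)) =
  f (\sum_r \sum_s 2%:R^-1 * V j (qV j m s) ^+ (p ^ 2)
          * invmx x r s ^+ (p ^ 2) * (C j k r + C k j r - C r j k) ^+ p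
     - \sum_r \sum_s 2%:R^-1 * V i (qV i m s) ^+ (p ^ 2)
          * invmx x r s ^+ (p ^ 2) * (C i k r + C k i r - C r i k) ^+ p).
Proof.
rewrite [LHS](commutator_red p_prime A_tf unit2 transported_liftE
  x_unit transported_form_sym transported_form_inv transported_metric
  transported_torsion_free fp).
congr (f (_ - _)); apply: eq_bigr => r _; apply: eq_bigr => s _;
  by rewrite !transported_C_liftE [QV _ _ _]mxE.
Qed.

Lemma curvature_red1 i j m k : map_mx f x = 1%:M ->
  f (transported_curvature i j (x m k)) =
  f (\sum_r 2%:R^-1 * V i (qV i m r) ^+ (p ^ 2)
          * (V i (delta i (q i k r)) + V k (delta k (q k i r))
             - V r (delta r (q r i k))) ^+ p
     - \sum_r 2%:R^-1 * V j (qV j m r) ^+ (p ^ 2)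
          * (V j (delta j (q j k r)) + V k (delta k (q k j r))
             - V r (delta r (q r j k))) ^+ p).
Proof.
move=> fx.
rewrite [LHS](commutator_red1 p_prime p_odd A_tf unit2 transported_liftE
  x_unit transported_form_sym transported_form_inv
  transported_metric transported_torsion_free fp fx).
congr (f (_ - _)); apply: eq_bigr => r _;
  by rewrite !transported_derivE [QV _ _ _]mxE.
Qed.

End Reduction.

End TransportedConnection.

(** * The curvature of the vertical Levi-Civita connection *)

Theorem proposition3p2
  (F : splittingFieldType rat) (F_galois : galois 1 {:F})
  (d M : int) (d_disc : is_discriminant F d)
  (M_even : (2 %| M)%Z) (d_dvd_M : (d %| M)%Z)
  (n : nat) (sigma : 'I_n.+1 -> gal_of {:F})
  (sigma_gal : forall i, sigma i \in 'Gal({:F} / 1)%g)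
  (sigma_1 : sigma ord0 = 1%g)
  (p : nat) (p_prime : prime p) (p_ndvd_M : ~~ (p%:Z %| M)%Z)
  (P : prime_over F p)
  (q : 'M[F]_n.+1) (q_GL : in_GL_away M q) (q_sym : q^T = q)
  (deltaR : forall i, Rhat_at P sigma i -> Rhat_at P sigma i)
  (deltaR_der : forall i, p_derivation p (deltaR i))
  (sigmaG : forall i, {rmorphism Ghat_at P sigma ord0 -> Ghat_at P sigma i})
  (sigmaG_induced : forall i, induced_by (sigma i) (sigmaG i))
  (sigmaV : forall i, Ghat_at P sigma i -> Ghat_at P sigma ord0)
  (sigmaGK : forall i, cancel (sigmaG i) (sigmaV i))
  (sigmaVK : forall i, cancel (sigmaV i) (sigmaG i))
  (delta : forall i, Ghat_at P sigma i -> Ghat_at P sigma i)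
  (delta_LC : levi_civita deltaR delta sigmaV q) :
  let Phi := Phi_mx delta (fun i => sigmaG i) sigmaV in
  let C := C_mx delta sigmaV q in
  let x := x_at P sigma ord0 in
  let qV j m s := sigmaV j (mx_at P sigma j (invmx q) m s) in
  let dq j k r := sigmaV j (delta j (mx_at P sigma j q k r)) in
  forall i j m k : 'I_n.+1,
    cong_mod p (Phi i j m k)
      (\sum_r \sum_s 2%:R^-1 * qV j m s ^+ (p ^ 2) * invmx x r s ^+ (p ^ 2)
          * (C j k r + C k j r - C r j k) ^+ p
       - \sum_r \sum_s 2%:R^-1 * qV i m s ^+ (p ^ 2) * invmx x r s ^+ (p ^ 2)
          * (C i k r + C k i r - C r i k) ^+ p)
    /\
    cong_mod_x1 (Phi i j m k)
      (\sum_r 2%:R^-1 * qV i m r ^+ (p ^ 2)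
          * (dq i k r + dq k i r - dq r i k) ^+ p
       - \sum_r 2%:R^-1 * qV j m r ^+ (p ^ 2)
          * (dq j k r + dq k j r - dq r j k) ^+ p).
Proof.
move=> Phi C x qV dq i j m k.
(* The prime 2 is excluded because it divides [M]. *)
have p_odd : odd p.
  case: (even_prime p_prime) p_ndvd_M => // ->.
  by rewrite dvdzE -dvdzE M_even.
have p_M : coprimez p M by rewrite coprimezE prime_coprime.
have p_2 : coprimez p 2 by rewrite coprimezE coprimen2.
have A_tf := @Ghat_torsion_free F p (prime_at P sigma ord0) n.+1
  (prime_gt0 p_prime).
have unit2 := @Ghat_unit2 F p (prime_at P sigma ord0) n.+1 p_2.
have x_unit : x \in unitmx := Ghat_x_unit (prime_at P sigma ord0) n.+1.
have [q_unit q_loc qV_loc] := q_GL.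
have Gx l : map_mx (sigmaG l) x = x_at P sigma l.
  by have [sigmaR []] := sigmaG_induced l.
have Qsym l : (mx_at P sigma l q)^T = mx_at P sigma l q.
  by rewrite /mx_at map_trmx q_sym.
(* The entries of [q] and its inverse have powers of [M] as denominators, so they lie in the
   localization at every conjugate of [P]. *)
have QVK l : mx_at P sigma l q *m mx_at P sigma l (invmx q) = 1%:M.
  apply: to_Ghat_mulmx1; last exact: mulmxV.
    by move=> u v; apply: int_away_localized p_M _.
  by move=> u v; apply: int_away_localized p_M _.
have [lift met tf] := delta_LC.
have phi_lift l : frobenius_lift p (attached p (delta l)).
  by have [] := lift l.
(* This is the relation between [H] and [phi0] evaluated on the coordinates: [phi0 x] is [x^(p)],
   and the morphism [H] commutes with powers. *)
have phi_metric l : map_mx (attached p (delta l))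
      ((x_at P sigma l)^T *m mx_at P sigma l q *m x_at P sigma l)
    = frob_mx p ((x_at P sigma l)^T *m mx_at P sigma l q *m x_at P sigma l).
  have [H [phi0 [[_ <-] _ _ phi0x phiH]]] := met l.
  rewrite frob_map_rmorphism -phi0x; move: (x_at P sigma l) => y.
  by apply/matrixP => u v; rewrite !mxE; apply: phiH.
have PhiE : Phi i j m k
    = transported_curvature p (fun l => sigmaG l) sigmaV delta i j (x m k).
  by rewrite mxE.
rewrite PhiE; split.
  apply: cong_mod_redP => S f fp.
  exact: (curvature_red p_prime A_tf unit2 x_unit sigmaGK sigmaVK Gx Qsym QVK
    phi_lift phi_metric tf fp i j m k).
apply: cong_mod_mx1_redP => S f fp fx.
exact: (curvature_red1 p_prime p_odd A_tf unit2 x_unit sigmaGK sigmaVK Gx Qsym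
  QVK phi_lift phi_metric tf fp i j m k fx).
Qed.
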